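(* Let $N\in\mathbb{Z}_{\ge2}$ and let $b_1,\dots,b_t$ be any ordering of $\mathscr{B}_N$, with associated sequence $\Delta_1,\dots,\Delta_t$. Then the vectors $$\sum_{j=1}^t c_{b_j}e_{b_j}-\Big(\sum_{j=1}^t c_{b_j}\Big)e_1,\qquad c_{b_j}\in\mathbb{Z},\ 0\le c_{b_j}<\Delta_j,$$ form a complete system of representatives of $S(N)/Z(N)$.
   Context: $\mathscr{D}(N)$ is the set of positive divisors of $N$, $\{e_n\}_{n\mid N}$ the standard basis of $\mathbb{Z}^{\mathscr{D}(N)}$. $S(N)=\{(r_n)_{n\mid N}\in\mathbb{Z}^{\mathscr{D}(N)}:\sum_n r_n=0\}$. $Z(N)$ is the subgroup of $(r_n)\in S(N)$ with $\sum_{n\mid N}nr_n\equiv0\pmod{24}$, $\sum_{n\mid N}\frac Nn r_n\equiv0\pmod{24}$, and $\prod_{n:\,r_n\text{ odd}}n$ a perfect square. For a prime $p\mid N$: $\mathscr{B}_N^p=\{p\}$ if $p\ne2,3$; $\mathscr{B}_N^2=\{2\}$ if $v_2(N)=1$, $\{2,4\}$ if $v_2(N)=2$, $\{2^{\alpha-2},2^{\alpha-1},2^\alpha\}$ if $v_2(N)=\alpha\ge3$; $\mathscr{B}_N^3=\{3\}$ if $v_3(N)=1$, $\{3^{\alpha-1},3^\alpha\}$ if $v_3(N)=\alpha\ge2$; $\mathscr{B}_N=\bigcup_{p\mid N}\mathscr{B}_N^p$. For integers $(c_n)_{n\in\mathscr{B}_N}$ consider the system (S): $\sum_{n\in\mathscr{B}_N}(n-1)c_n\equiv0\pmod{24}$;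 $\sum_{n\in\mathscr{B}_N}(N/n-N)c_n\equiv0\pmod{24}$; $c_p\equiv0\pmod2$ for every prime $p\mid N$, $p\ne2,3$; $\sum_{2^\beta\in\mathscr{B}_N,\,c_{2^\beta}\text{ odd}}\beta\equiv0\pmod2$ and $\sum_{3^\beta\in\mathscr{B}_N,\,c_{3^\beta}\text{ odd}}\beta\equiv0\pmod2$. For an ordering $b_1,\dots,b_t$ of $\mathscr{B}_N$, $\Delta_i$ is the least $m\in\{1,\dots,24\}$ such that some $(c_n)$ satisfies (S) with $c_{b_j}=0$ for $j<i$ and $c_{b_i}=m$. *)

(* Defs.v *)
From mathcomp Require Import all_boot all_order all_algebra.
Set Implicit Arguments. Unset Strict Implicit. Unset Printing Implicit Defensive.
Import GRing.Theory Num.Theory.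
Local Open Scope ring_scope.

(* Vectors of Z^{D(N)} are represented by functions r : nat -> int; only the
   values r n for n in divisors N are ever used. *)

Definition Bp (N p : nat) : seq nat :=
  let a := logn p N in
  if p == 2%N then
    match a with
    | 0 => [::]
    | 1 => [:: 2%N]
    | 2 => [:: 2%N; 4%N]
    | _ => [:: (2 ^ (a - 2))%N; (2 ^ (a - 1))%N; (2 ^ a)%N]
    end
  else if p == 3%N then
    match a with
    | 0 => [::]
    | 1 => [:: 3%N]
    | _ => [:: (3 ^ (a - 1))%N; (3 ^ a)%N]
    end
  else if a == 0%N then [::] else [:: p].

Definition BN (N : nat) : seq nat := flatten [seq Bp N p | p <- primes N].

Definition inS (N : nat) (r : nat -> int) : Prop :=
  \sum_(n <- divisors N) r n = 0.

Definition inZ (N : nat) (r : nat -> int) : Prop :=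
  [/\ inS N r,
      (24 %| \sum_(n <- divisors N) n%:Z * r n)%Z,
      (24 %| \sum_(n <- divisors N) (N %/ n)%N%:Z * r n)%Z &
      exists k : nat, (\prod_(n <- divisors N | ~~ (2 %| r n)%Z) n)%N = (k ^ 2)%N].

Definition systemS (N : nat) (c : nat -> int) : Prop :=
  [/\ (24 %| \sum_(n <- BN N) (n%:Z - 1) * c n)%Z,
      (24 %| \sum_(n <- BN N) ((N %/ n)%N%:Z - N%:Z) * c n)%Z,
      (forall p, prime p -> (p %| N)%N -> p != 2%N -> p != 3%N -> (2 %| c p)%Z),
      ~~ odd (\sum_(n <- Bp N 2 | ~~ (2 %| c n)%Z) logn 2 n) &
      ~~ odd (\sum_(n <- Bp N 3 | ~~ (2 %| c n)%Z) logn 3 n)].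

Definition admissible (N : nat) (b : seq nat) (i m : nat) : Prop :=
  exists c : nat -> int, [/\ systemS N c,
    (forall j, (j < i)%N -> c (nth 0%N b j) = 0) &
    c (nth 0%N b i) = m%:Z].

Definition isDelta (N : nat) (b : seq nat) (i m : nat) : Prop :=
  [/\ (1 <= m <= 24)%N, admissible N b i m &
      forall m', (1 <= m')%N -> (m' < m)%N -> ~ admissible N b i m'].

Definition repvec (b : seq nat) (d : nat -> int) : nat -> int :=
  fun n => \sum_(j < size b) (if nth 0%N b j == n then d j else 0)
           - (if n == 1%N then \sum_(j < size b) d j else 0).

(* Main.v *)
Require Import Defs.
From mathcomp Require Import all_boot all_order all_algebra.
From mathcomp Require Import zify ring.
Import GRing.Theory Num.Theory.
Local Open Scope ring_scope.

(** The conditions defining Z(N), and likewise the system (S), say that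
    certain linear forms vanish: sum n r_n and sum (N/n) r_n modulo 24, and
    sum v_p(n) r_n modulo 2 for every prime p. The main point is that the classes
    of e_n - e_1 with n in B_N generate S(N)/Z(N). By the Chinese remainder theorem
    the two conditions modulo 24 may be treated modulo 8 (together with the
    parities) and modulo 3 separately. Modulo 8 every odd prime p satisfies p^2 = 1,
    so e_(pn) - e_1 is congruent to (e_p - e_1) + p (e_n - e_1), and one is reduced to
    powers of 2, where explicit combinations work; modulo 3 the same argument
    reduces to powers of 3. Since (S) describes the lattice of relations among these
    generators, Delta_1, ..., Delta_t are the diagonal entries of a triangular basis of
    that lattice, and division with remainder gives the representatives. *)

(** * The conditions of [inZ] as congruences on weights *)

(* Taking [l = 1] discards the parity conditions. *)
Variant weight (k l : int) (N : nat) : int -> (nat -> int) -> Prop :=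
| WeightId : weight k l N k (fun n => n%:Z)
| WeightCodiv : weight k l N k (fun n => (N %/ n)%N%:Z)
| WeightLog p : prime p -> weight k l N l (fun n => (logn p n)%:Z).

(** Modulo 2 an odd [r n] counts as 1 and an even one as 0. This links linear congruences with the
    sums over odd coefficients used in the definitions. *)
Lemma odd_sum_dvdz (s : seq nat) (g : nat -> nat) (r : nat -> int) :
  (2 %| \sum_(n <- s) (g n)%:Z * r n)%Z =
  ~~ odd (\sum_(n <- s | ~~ (2 %| r n)%Z) g n).
Proof.
elim: s => [|n s IHs]; first by rewrite !big_nil dvdz0.
rewrite !big_cons; move: IHs; set A := \sum_(j <- s) _.
set B := (\sum_(j <- s | _) _)%N => IHs; case: ifPn => h.
  have [e re] : exists e : int, r n = 2 * e + 1.
    by exists ((r n) %/ 2)%Z; move: h; lia.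
  rewrite oddD re (_ : _ * _ = 2 * ((g n)%:Z * e) + (g n)%:Z); last by ring.
  move: IHs; set x := (g n)%:Z * e; lia.
move/negPn/dvdzP: h => [e ->].
rewrite (_ : _ * _ = 2 * ((g n)%:Z * e)); last by ring.
move: IHs; set x := (g n)%:Z * e; lia.
Qed.

(** Halving every exponent of the prime decomposition yields the root. *)
Lemma squareP (m : nat) : (0 < m)%N ->
  (exists k, m = (k ^ 2)%N) <-> (forall p, prime p -> ~~ odd (logn p m)).
Proof.
move=> m_gt0; split=> [[k ->] p _|ev]; first by rewrite lognX mul2n odd_double.
exists (\prod_(f <- prime_decomp m) f.1 ^ f.2./2)%N.
rewrite [LHS]prod_prime_decomp // -mulnn -big_split /=.
apply: eq_big_seq => -[p e] /=; rewrite prime_decompE => /mapP [q qm [-> ->]].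
rewrite -expnD addnn even_halfK // ev //.
by move: qm; rewrite mem_primes => /andP [].
Qed.

Lemma logn_prod_cond (p : nat) (s : seq nat) (P : pred nat) :
  all (leq 1) s ->
  (0 < \prod_(n <- s | P n) n)%N /\
  logn p (\prod_(n <- s | P n) n) = (\sum_(n <- s | P n) logn p n)%N.
Proof.
elim: s => [|n s IHs] /=; first by rewrite !big_nil logn1.
move=> /andP [n0 /IHs [h1 h2]]; rewrite !big_cons; case: ifP => // _.
by rewrite muln_gt0 n0 h1 lognM // h2.
Qed.

(** By [squareP], being a square means that all valuations are even. Valuations turn the product
    into a sum, so the square condition becomes one congruence modulo 2 for each prime. *)
Lemma inZP (N : nat) (r : nat -> int) : inZ N r <->
  inS N r /\ forall q F, weight 24 2 N q F ->
    (q %| \sum_(n <- divisors N) F n * r n)%Z.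
Proof.
have pos : all (leq 1) (divisors N).
  (* [divisors 0] evaluates to [[:: 1]], which settles [N = 0]. *)
  apply/allP => n; case: N => [|N]; first by rewrite inE => /eqP ->.
  by rewrite -dvdn_divisors // => /dvdn_gt0; apply.
set P := fun n => ~~ (2 %| r n)%Z.
have [pr0 _] := logn_prod_cond 0 _ P pos.
split=> [[h1 h2 h3 /(squareP _ pr0) h4]|[h1 h]].
  split=> // q F [] //= p pp.
  rewrite odd_sum_dvdz; have := h4 p pp.
  by have [_ ->] := logn_prod_cond p _ P pos.
split => //; first exact: h _ _ (WeightId _ _ _).
  exact: h _ _ (WeightCodiv _ _ _).
apply/(squareP _ pr0) => p pp; have := h _ _ (WeightLog _ _ _ _ pp).
by rewrite odd_sum_dvdz; have [_ ->] := logn_prod_cond p _ P pos.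
Qed.

(** * Structure of [BN], and the system (S) as congruences on weights *)

Lemma Bp_pow (N p n : nat) : prime p -> n \in Bp N p ->
  exists e, [/\ (0 < e)%N, (e <= logn p N)%N & n = (p ^ e)%N].
Proof.
move=> pp; rewrite /Bp.
case: eqP => [->|_].
  case: (logn 2 N) => [|[|[|a]]]; rewrite ?in_nil // !inE.
  - by move/eqP ->; exists 1%N.
  - by case/orP => /eqP ->; [exists 1%N|exists 2%N].
  by case/or3P => /eqP ->; [exists (a.+3 - 2)%N|exists (a.+3 - 1)%N|exists a.+3];
   split => //; lia.
case: eqP => [->|_].
  case: (logn 3 N) => [|[|a]]; rewrite ?in_nil // !inE.
  - by move/eqP ->; exists 1%N.
  by case/orP => /eqP ->; [exists (a.+2 - 1)%N|exists a.+2]; split => //; lia.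
case: ifPn => // h; rewrite inE => /eqP ->; exists 1%N; rewrite lt0n; split=> //.
by rewrite lt0n.
Qed.

Lemma uniq_Bp (N p : nat) : uniq (Bp N p).
Proof.
rewrite /Bp; case: eqP => [->|_].
  case: (logn 2 N) => [|[|[|a]]] //; rewrite !cons_uniq !inE !eqn_exp2l ?andbT ?orbF //; lia.
case: eqP => [->|_].
  case: (logn 3 N) => [|[|a]] //; rewrite !cons_uniq !inE !eqn_exp2l ?andbT ?orbF //; lia.
by case: ifP.
Qed.

(** An element determines the prime of its block, so blocks of different primes are disjoint. *)
Lemma pdiv_Bp (N p n : nat) : prime p -> n \in Bp N p -> pdiv n = p.
Proof.
by move=> pp /(Bp_pow _ _ _ pp) [[|e] [// _ _ ->]]; rewrite pdiv_pfactor.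
Qed.

Lemma uniq_BN (N : nat) : uniq (BN N).
Proof.
rewrite /BN; have: all prime (primes N).
  by apply/allP => p; rewrite mem_primes => /andP [].
elim: (primes N) (primes_uniq N) => //= p s IHs /andP [pns us] /andP [pp aps].
rewrite cat_uniq uniq_Bp IHs // andbT /=; apply/hasPn => n /flatten_mapP [q qs nq].
apply: contra pns => /= np; rewrite -(pdiv_Bp _ _ _ pp np) (pdiv_Bp N q) //.
exact: (allP aps).
Qed.

Lemma mem_BN (N p n : nat) :
  prime p -> (p %| N)%N -> (0 < N)%N -> n \in Bp N p -> n \in BN N.
Proof.
move=> pp pN N0 np; apply/flatten_mapP; exists p => //.
by rewrite mem_primes pp N0.
Qed.

Lemma BN_dvd (N n : nat) : n \in BN N -> (n %| N)%N.
Proof.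
case/flatten_mapP => p; rewrite mem_primes => /and3P [pp N0 pN].
move/(Bp_pow _ _ _ pp) => [e [_ le ->]].
by rewrite pfactor_dvdn.
Qed.

(** The valuation at [p] vanishes on powers of other primes, so only the block of [p] contributes;
    if [p] does not divide [N], that block is empty. *)
Lemma sum_BN_log (N p : nat) (c : nat -> int) : prime p ->
  \sum_(n <- BN N) (logn p n)%:Z * c n = \sum_(n <- Bp N p) (logn p n)%:Z * c n.
Proof.
move=> pp; rewrite /BN big_flatten big_map /=.
have zero q : prime q -> q != p -> \sum_(n <- Bp N q) (logn p n)%:Z * c n = 0.
  move=> qq /negPf qp; rewrite big_seq big1 // => n.
  move=> /(Bp_pow _ _ _ qq) [e [_ _ ->]].
  by rewrite lognX logn_prime // eq_sym qp muln0 mul0r.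
case: (boolP (p \in primes N)) => h.
  rewrite (bigD1_seq p) ?primes_uniq //=.
  rewrite [X in _ + X]big_seq_cond [X in _ + X]big1 ?addr0 // => q.
  by rewrite mem_primes => /andP [/andP [qq _]]; exact: zero.
rewrite big_seq big1; last first.
  move=> q qN; apply: zero; first by move: qN; rewrite mem_primes => /andP [].
  by apply: contraNneq h => <-.
suff -> : Bp N p = [::] by rewrite big_nil.
have := logn_gt0 p N; rewrite (negPf h) lt0n => /negbFE /eqP l0.
by rewrite /Bp; case: eqP => [E|_]; [|case: eqP => [E|_]]; subst; rewrite ?l0.
Qed.

(** The coefficients in (S) are the values of the weights on $e_n - e_1$. For a prime $p \ge 5$
    dividing [N] the block is $\{p\}$, and the form given by $v_p$ is $c_p$ itself; for $p$ not
    dividing [N] it is zero. *)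
Lemma systemSP (N : nat) (c : nat -> int) : (0 < N)%N -> systemS N c <->
  forall q F, weight 24 2 N q F ->
    (q %| \sum_(n <- BN N) (F n - F 1%N) * c n)%Z.
Proof.
move=> N0.
have sumlog p : prime p -> \sum_(n <- BN N) ((logn p n)%:Z - (logn p 1)%:Z) * c n
    = \sum_(n <- Bp N p) (logn p n)%:Z * c n.
  move=> pp; rewrite -sum_BN_log //; apply: eq_bigr => n _.
  by rewrite logn1 subr0.
have big p : prime p -> (p %| N)%N -> p != 2%N -> p != 3%N ->
    \sum_(n <- Bp N p) (logn p n)%:Z * c n = c p.
  move=> pp pN /negPf p2 /negPf p3; rewrite /Bp p2 p3.
  have := logn_gt0 p N; rewrite mem_primes pp N0 pN lt0n /= => /negPf ->.
  by rewrite big_seq1 logn_prime // eqxx mul1r.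
split=> [[h1 h2 h3 h4 h5] q F [|| p pp]|h].
- exact: h1.
- by under eq_bigr do rewrite divn1; exact: h2.
- rewrite sumlog //; have [p2|p2] := eqVneq p 2%N; first by rewrite p2 odd_sum_dvdz.
  have [p3|p3] := eqVneq p 3%N; first by rewrite p3 odd_sum_dvdz.
  have [pN|pN] := boolP (p %| N)%N; first by rewrite big // h3.
  by rewrite /Bp (negPf p2) (negPf p3) lognE (negPf pN) !andbF big_nil.
split.
- exact: h _ _ (WeightId _ _ _).
- by have := h _ _ (WeightCodiv _ _ _); under eq_bigr do rewrite divn1.
- move=> p pp pN p2 p3; have := h _ _ (WeightLog _ _ _ _ pp).
  by rewrite sumlog // big.
- by have := h _ _ (WeightLog _ _ _ 2%N isT); rewrite sumlog // odd_sum_dvdz.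
- by have := h _ _ (WeightLog _ _ _ 3%N isT); rewrite sumlog // odd_sum_dvdz.
Qed.

(** * The integral span of the vectors $e_n - e_1$ with $n$ in [BN] *)

(** A vector enters only through its pairing [T] with weights. One and the same [c] has to serve all
    weights at once. *)
Definition spanned (k l : int) (N : nat) (T : (nat -> int) -> int) : Prop :=
  exists c : nat -> int, forall q F, weight k l N q F ->
    (q %| T F - \sum_(n <- BN N) (F n - F 1%N) * c n)%Z.

Section Span.

Variables (k l : int) (N : nat).
Hypothesis N0 : (0 < N)%N.

Notation span := (spanned k l N).

Lemma spanned0 : span (fun => 0).
Proof.
exists (fun => 0) => q F _; rewrite big1 ?subr0 ?dvdz0 // => n _.
by rewrite mulr0.
Qed.

Lemma spanned_lin (x y : int) T U :
  span T -> span U -> span (fun F => x * T F + y * U F).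
Proof.
move=> [c hc] [d hd]; exists (fun n => x * c n + y * d n) => q F w.
have -> : \sum_(n <- BN N) (F n - F 1%N) * (x * c n + y * d n) =
    x * (\sum_(n <- BN N) (F n - F 1%N) * c n)
    + y * (\sum_(n <- BN N) (F n - F 1%N) * d n).
  rewrite !mulr_sumr -big_split /=; apply: eq_bigr => n _; ring.
have := rpredD (dvdz_mull x (hc q F w)) (dvdz_mull y (hd q F w)).
by rewrite (_ : forall a b c d, x * (a - b) + y * (c - d)
   = x * a + y * c - (x * b + y * d)) // => *; ring.
Qed.

Lemma spanned_congr T U : span T ->
  (forall q F, weight k l N q F -> (q %| U F - T F)%Z) -> span U.
Proof.
move=> [c hc] h; exists c => q F w; have := rpredD (h q F w) (hc q F w).
by rewrite addrA subrK.
Qed.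

Lemma spanned_BN n : n \in BN N -> span (fun F => F n - F 1%N).
Proof.
move=> nB; exists (fun m => (m == n)%:R) => q F _.
rewrite (bigD1_seq n) ?uniq_BN //= eqxx mulr1 big1 ?addr0 ?subrr ?dvdz0 //.
by move=> m /negPf ->; rewrite mulr0.
Qed.

(* [p^2 = 1] mod [k] makes both [n] and [N/n] scale by [p] under [n -> p n]. *)
Lemma spanned_mul p j n : prime p -> odd j -> (p ^ j)%N \in BN N ->
  (k %| p%:Z ^+ 2 - 1)%Z -> (l %| p%:Z - 1)%Z -> (l %| 2)%Z ->
  (p * n %| N)%N ->
  span (fun F => F n - F 1%N) -> span (fun F => F (p * n)%N - F 1%N).
Proof.
move=> pp jo pB kp lp l2 pnN sn.
have p0 := prime_gt0 pp.
have n0 : (0 < n)%N.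
  by case: (posnP n) pnN => // ->; rewrite muln0 dvd0n; move/eqP: N0; lia.
(* An odd power $p^j$ stands in for [p]: the two agree modulo [k], and since [j] is odd their
   valuations agree modulo [l]. *)
apply: (spanned_congr _ _ (spanned_lin 1 p%:Z _ _ (spanned_BN _ pB) sn)).
have kpj : (k %| (p ^ j)%N%:Z - p%:Z)%Z.
  rewrite -(odd_double_half j) jo add1n expnS -mul2n expnM PoszM.
  rewrite -[X in _ - X]mulr1 -mulrBr; apply: dvdz_mull.
  elim: (j./2) => [|i IHi]; first by rewrite subrr dvdz0.
  rewrite expnS PoszM (_ : _ - 1 =
    (p ^ 2)%N%:Z * (((p ^ 2) ^ i)%N%:Z - 1) + (p%:Z ^+ 2 - 1)); last first.
    by rewrite -mulnn PoszM; ring.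
  by apply: rpredD => //; apply: dvdz_mull.
have [z zE] := dvdnP (BN_dvd _ _ pB).
have [w wE] := dvdnP pnN.
move=> q F [||r rr] /=.
- rewrite PoszM (_ : _ - _ = - ((p ^ j)%N%:Z - p%:Z)) ?rpredN //; ring.
- have -> : (N %/ (p * n))%N = w by rewrite wE mulnK // muln_gt0 p0.
  have -> : (N %/ p ^ j)%N = z by rewrite zE mulnK // expn_gt0 p0.
  have -> : (N %/ n)%N = (p * w)%N by rewrite wE mulnCA mulnA mulnK.
  rewrite divn1 PoszM.
  have -> : w%:Z - N%:Z - (1 * (z%:Z - N%:Z) + p%:Z * (p%:Z * w%:Z - N%:Z)) =
    (z%:Z - w%:Z) * (p%:Z ^+ 2 - 1) + p%:Z * (N%:Z - z%:Z * p%:Z) by ring.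
  apply: rpredD; first exact: dvdz_mull.
  by rewrite zE PoszM -mulrBr mulrCA; do 2 apply: dvdz_mull.
rewrite logn1 !subr0 lognM // PoszD lognX PoszM.
have -> : (logn r p)%:Z + (logn r n)%:Z
   - (1 * (j%:Z * (logn r p)%:Z) + p%:Z * (logn r n)%:Z) =
  - (logn r n)%:Z * (p%:Z - 1) - (logn r p)%:Z * (j%:Z - 1) by ring.
apply: rpredB; apply: dvdz_mull => //.
apply: dvdz_trans l2 _; lia.
Qed.

(** Strong induction on [n]: prime factors other than [b] are split off by [spanned_mul] until a
    power of [b] remains. *)
Lemma spanned_divisors (b : nat) : prime b ->
  (forall i, (b ^ i %| N)%N -> span (fun F => F (b ^ i)%N - F 1%N)) ->
  (forall p, prime p -> (p %| N)%N -> p != b ->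
    (k %| p%:Z ^+ 2 - 1)%Z /\ (l %| p%:Z - 1)%Z) ->
  (l %| 2)%Z ->
  (forall p, prime p -> (p %| N)%N -> exists2 j, odd j & (p ^ j)%N \in BN N) ->
  forall n, (n %| N)%N -> span (fun F => F n - F 1%N).
Proof.
move=> bp base kl l2 ex; elim/ltn_ind => n IHn nN.
have n0 : (0 < n)%N by apply: dvdn_gt0 nN.
case: (boolP (b.-nat n)) => [/p_natP [i E]|].
  by rewrite E; apply: base; rewrite -E.
rewrite /pnat n0 /= => /allPn [p]; rewrite mem_primes n0 /= => /andP [pp pn] pb.
have pN := dvdn_trans pn nN.
have [j jo pB] := ex p pp pN.
case/dvdnP: pn => m E; rewrite E mulnC.
have [h1 h2] := kl p pp pN pb.
apply: (spanned_mul _ j) => //; first by rewrite mulnC -E.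
apply: IHn; last by apply: dvdn_trans nN; rewrite E dvdn_mulr.
by rewrite E ltn_Pmulr ?prime_gt1 //; move: n0; rewrite E muln_gt0 => /andP [].
Qed.

End Span.

(** * Generation modulo 3, modulo 8 and modulo 24 *)

(** The block of [p] contains [p] itself or two powers with consecutive exponents, one of which is
    odd. *)
Lemma BN_odd_power (N p : nat) : (0 < N)%N -> prime p -> (p %| N)%N ->
  exists2 j, odd j & (p ^ j)%N \in BN N.
Proof.
move=> N0 pp pN.
suff [j jo h] : exists2 j, odd j & (p ^ j)%N \in Bp N p.
  by exists j => //; apply: mem_BN h.
have : (0 < logn p N)%N by rewrite logn_gt0 mem_primes pp N0.
rewrite /Bp; case: eqP => [->|_].
  case: (logn 2 N) => [|[|[|a]]] // _; try by exists 1%N.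
  have [h|h] := boolP (odd a); first by exists a.+2 => //=; rewrite ?h // !inE subn1 eqxx orbT.
  by exists a.+3 => //=; rewrite ?h // !inE eqxx !orbT.
case: eqP => [->|_].
  case: (logn 3 N) => [|[|a]] // _; try by exists 1%N.
  have [h|h] := boolP (odd a); last by exists a.+1 => //=; rewrite ?h // !inE subn1 eqxx.
  by exists a.+2 => //=; rewrite ?h // !inE eqxx !orbT.
by case: (logn p N) => //= _ _; exists 1%N => //; rewrite expn1 inE.
Qed.

Lemma spanned_mod3 (N n : nat) : (0 < N)%N -> (n %| N)%N ->
  spanned 3 1 N (fun F => F n - F 1%N).
Proof.
move=> N0.
have inv3 p : prime p -> (p %| N)%N -> p != 3%N ->
    (3 %| p%:Z ^+ 2 - 1)%Z /\ (1 %| p%:Z - 1)%Z.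
  move=> pp _ p3; split; last exact: dvd1z.
  have h : ~~ (3 %| p)%N by rewrite dvdn_prime2 // eq_sym.
  have [u [pu|pu]] : exists u : int, p%:Z = 3 * u + 1 \/ p%:Z = 3 * u + 2.
  - by exists (p %/ 3)%N%:Z; lia.
  - rewrite pu (_ : _ - 1 = (3 * u ^+ 2 + 2 * u) * 3); last by ring.
    exact: dvdz_mull.
  rewrite pu (_ : _ - 1 = (3 * u ^+ 2 + 4 * u + 1) * 3); last by ring.
  exact: dvdz_mull.
apply: (spanned_divisors _ _ _ N0 3) inv3 _ (fun p => BN_odd_power N p N0) n => //.
move=> i; rewrite pfactor_dvdn //.
case: i => [|i] iN; first
  by apply: spanned_congr (spanned0 _ _ _) _ => q F _; rewrite subrr dvdz0.
have N3 : (3 %| N)%N.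
  by have := logn_gt0 3 N; rewrite (leq_trans _ iN) // mem_primes N0 => /esym.
have B3 m : m \in Bp N 3 -> spanned 3 1 N (fun F => F m - F 1%N).
  by move=> h; apply: spanned_BN => //; apply: mem_BN h.
move: (B3); rewrite /Bp /=; case E: (logn 3 N) iN => [|[|a]] // iN {}B3.
  by have -> : i.+1 = 1%N; [lia | apply: B3].
have [->|ia] := eqVneq i a.+1; first by apply: B3; rewrite !inE eqxx orbT.
(* Here $v_3(N) = a + 2$. Strictly between the exponents 0 and $a+2$, both the power of 3 and its
   codivisor vanish modulo 3, so all these powers behave like $3^{a+1}$. *)
have dvd3 j : (j < a.+2)%N -> (3 %| (N %/ 3 ^ j)%N%:Z)%Z.
  move=> ja; rewrite -[(3 %| _)%Z]/(3 %| N %/ 3 ^ j)%N.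
  have : (3 ^ j.+1 %| N)%N by rewrite pfactor_dvdn // E.
  case/dvdnP => z ->; rewrite expnS mulnA mulnK ?expn_gt0 // dvdn_mull //.
apply: spanned_congr (B3 (3 ^ a.+1)%N _) _; first by rewrite !inE subn1 eqxx.
move=> q F [||r rr]; rewrite opprB addrA subrK.
- by apply: rpredB; rewrite expnS PoszM dvdz_mulr.
- by apply: rpredB; apply: dvd3; lia.
exact: dvd1z.
Qed.

(** If $v_2(N) \le 2$, the block of 2 holds all the positive powers required. Otherwise its three
    elements are recombined into vectors each detecting a single weight; the factor [1 + 4 * X] in
    [E1] is its own inverse modulo 8. *)
Lemma spanned_mod8_pow2 (N i : nat) : (0 < N)%N -> (2 ^ i %| N)%N ->
  spanned 8 2 N (fun F => F (2 ^ i)%N - F 1%N).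
Proof.
move=> N0; rewrite pfactor_dvdn //.
case: i => [|i] iN; first
  by apply: spanned_congr (spanned0 _ _ _) _ => q F _; rewrite subrr dvdz0.
have N2 : (2 %| N)%N.
  by have := logn_gt0 2 N; rewrite (leq_trans _ iN) // mem_primes N0 => /esym.
have B2 m : m \in Bp N 2 -> spanned 8 2 N (fun F => F m - F 1%N).
  by move=> h; apply: spanned_BN => //; apply: mem_BN h.
move: (B2); rewrite /Bp /=; case E: (logn 2 N) iN => [|[|[|a]]] // iN {}B2.
- by have -> : i.+1 = 1%N; [lia | apply: B2].
- by have : i = 0%N \/ i = 1%N by [lia]; case=> ->; apply: B2.
have T0 := B2 (2 ^ a.+3)%N; have T1 := B2 (2 ^ a.+2)%N; have T2 := B2 (2 ^ a.+1)%N.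
rewrite !inE !subSS !subn0 !eqxx ?orbT in T0 T1 T2.
move: {B2 T0 T1 T2} (T0 isT) (T1 isT) (T2 isT) => T0 T1 T2.
have [u uE] : exists u, N = (u * 2 ^ a.+3)%N.
  by apply/dvdnP; rewrite pfactor_dvdn // E.
have codiv j m : (m + j = a.+3)%N -> (N %/ 2 ^ j)%N%:Z = u%:Z * (2 ^ m)%N%:Z.
  by move=> jm; rewrite uE -jm expnD mulnA mulnK ?expn_gt0 // PoszM.
set X := (2 ^ a)%N%:Z.
have p1 : (2 ^ a.+1)%N%:Z = 2 * X by rewrite expnS PoszM.
have p2 : (2 ^ a.+2)%N%:Z = 4 * X by rewrite expnS PoszM p1; ring.
have p3 : (2 ^ a.+3)%N%:Z = 8 * X by rewrite expnS PoszM p2; ring.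
have log2 r j : prime r -> (logn r (2 ^ j))%:Z = j%:Z * (r == 2%N)%:R.
  by move=> rr; rewrite lognX logn_prime // PoszM; case: eqP.
(* For the weights (n mod 8, N/n mod 8, v_2 mod 2), [V], [E1], [E2] have values
   (0,0,1), (1,0,0), (0,u,0): with A = 2^(v_2 N), the vectors T1 - 2 T0 and
   T2 - 3 T1 + 2 T0 have values (1 + A/2, 0, v_2 N - 1) and (3A/4, 0, 1). *)
have U := spanned_lin _ _ _ 1 (-2) _ _ T1 T0.
have V := spanned_lin _ _ _ 1 (-1) _ _ (spanned_lin _ _ _ 1 (-3) _ _ T2 T1)
            (spanned_lin _ _ _ (6 * X) (-2) _ _ U T0).
have E1 := spanned_lin _ _ _ (1 + 4 * X) (-(1 + 4 * X) * a%:Z) _ _ U V.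
have E2 := spanned_lin _ _ _ 1 1 _ _ T0
   (spanned_lin _ _ _ 1 (- (a%:Z + 1)) _ _ E1 V).
(* As 8 divides [N], the target has values $(x, uy, i+1)$, which dictates its coefficients on [E1],
   [E2] and [V]. *)
pose x := (2 ^ i.+1)%N%:Z - 1; pose y := (2 ^ (a.+3 - i.+1))%N%:Z.
apply: spanned_congr (spanned_lin _ _ _ 1 y _ _
   (spanned_lin _ _ _ x (i%:Z + 1) _ _ E1 V) E2) _.
move=> q F [||r rr].
(* For each weight, [e1] and [e2] are the deviations of [E1] and [E2] from their intended values,
   divided by the modulus. *)
- pose e1 := - X - 6 * X ^+ 2 - 9 * a%:Z * (1 + 4 * X) * X ^+ 2.
  pose e2 := X + e1 - 9 * (a%:Z + 1) * X ^+ 2.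
  apply/dvdzP; exists (- x * e1 - 9 * (i%:Z + 1) * X ^+ 2 - y * e2).
  by rewrite p1 p2 p3 /e2 /e1 /x; ring.
- pose e1 := (1 + 4 * X) * (u%:Z * X + 6 * a%:Z * u%:Z * X ^+ 2).
  pose e2 := - u%:Z * X + e1 + 6 * (a%:Z + 1) * u%:Z * X ^+ 2.
  apply/dvdzP; exists (- u%:Z * X - x * e1 + 6 * (i%:Z + 1) * u%:Z * X ^+ 2 - y * e2).
  rewrite (codiv i.+1 (a.+3 - i.+1)%N) ?subnK // (codiv a.+1 2%N) //.
  rewrite (codiv a.+2 1%N) // (codiv a.+3 0%N) //.
  have -> : (N %/ 1)%N%:Z = u%:Z * (8 * X) by rewrite divn1 uE PoszM p3.
  by rewrite -/y (_ : (2 ^ 2)%N = 4%N) // expn1 expn0 /e2 /e1; ring.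
pose e1 := (1 + 4 * X) * (- a%:Z - 2 - 3 * a%:Z * X * (a%:Z + 4)).
pose e2 := 1 + e1 - 3 * (a%:Z + 1) * X * (a%:Z + 4).
apply/dvdzP; exists ((- x * e1 - 3 * (i%:Z + 1) * X * (a%:Z + 4) - y * e2)
                     * (r == 2%N)%:R).
rewrite logn1 !log2 // /e2 /e1.
have -> : a.+3%:Z = a%:Z + 3 by lia.
have -> : a.+2%:Z = a%:Z + 2 by lia.
have -> : a.+1%:Z = a%:Z + 1 by lia.
have -> : i.+1%:Z = i%:Z + 1 by lia.
by ring.
Qed.

Lemma spanned_mod8 (N n : nat) : (0 < N)%N -> (n %| N)%N ->
  spanned 8 2 N (fun F => F n - F 1%N).
Proof.
move=> N0.
have inv8 p : prime p -> (p %| N)%N -> p != 2%N ->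
    (8 %| p%:Z ^+ 2 - 1)%Z /\ (2 %| p%:Z - 1)%Z.
  move=> pp _ p2.
  have po : odd p by case: (even_prime pp) p2 => // ->.
  have [u pu] : exists u : int, [\/ p%:Z = 8 * u + 1, p%:Z = 8 * u + 3,
      p%:Z = 8 * u + 5 | p%:Z = 8 * u + 7].
    exists (p %/ 8)%N%:Z; have [h|[h|[h|h]]] : p%:Z = 8 * (p %/ 8)%N%:Z + 1 \/
      p%:Z = 8 * (p %/ 8)%N%:Z + 3 \/ p%:Z = 8 * (p %/ 8)%N%:Z + 5 \/
      p%:Z = 8 * (p %/ 8)%N%:Z + 7 by lia.
    - by apply: Or41. - by apply: Or42. - by apply: Or43. - by apply: Or44.
  split; last by lia.
  case: pu => ->; apply/dvdzP.
  - by exists (8 * u ^+ 2 + 2 * u); ring.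
  - by exists (8 * u ^+ 2 + 6 * u + 1); ring.
  - by exists (8 * u ^+ 2 + 10 * u + 3); ring.
  by exists (8 * u ^+ 2 + 14 * u + 6); ring.
apply: (spanned_divisors _ _ _ N0 2) inv8 _ (fun p => BN_odd_power N p N0) n => //.
by move=> i; apply: spanned_mod8_pow2.
Qed.

(** The coefficients 9 and -8 are the idempotents of the Chinese remainder theorem for 8 and 3. As 9
    is odd and 8 even, the parities come from the solution modulo 8 alone. *)
Lemma spanned_mod24 (N n : nat) : (0 < N)%N -> (n %| N)%N ->
  spanned 24 2 N (fun F => F n - F 1%N).
Proof.
move=> N0 nN; have [c3 h3] := spanned_mod3 _ _ N0 nN.
have [c8 h8] := spanned_mod8 _ _ N0 nN.
have crt T S8 S3 : (8 %| T - S8)%Z -> (3 %| T - S3)%Z ->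
    (24 %| T - (9 * S8 - 8 * S3))%Z.
  move=> /dvdzP [x hx] /dvdzP [y hy]; apply/dvdzP; exists (3 * x - y).
  have -> : T - (9 * S8 - 8 * S3) = 9 * (T - S8) - 8 * (T - S3) by ring.
  by rewrite hx hy; ring.
exists (fun m => 9 * c8 m - 8 * c3 m) => q F w.
have -> : \sum_(n <- BN N) (F n - F 1%N) * (9 * c8 n - 8 * c3 n) =
    9 * (\sum_(n <- BN N) (F n - F 1%N) * c8 n)
    - 8 * (\sum_(n <- BN N) (F n - F 1%N) * c3 n).
  rewrite !mulr_sumr -sumrB; apply: eq_bigr => m _; ring.
case: w => [||p pp].
- by apply: crt; [apply: h8|apply: h3]; apply: WeightId.
- by apply: crt; [apply: h8|apply: h3]; apply: WeightCodiv.
have := h8 _ _ (WeightLog _ _ _ _ pp).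
set S8 := \sum_(_ <- _) _; set S3 := \sum_(_ <- _) _.
move=> /dvdzP [x hx]; apply/dvdzP; exists (x - 4 * S8 + 4 * S3).
have -> : forall T, T - (9 * S8 - 8 * S3) = T - S8 + (- 4 * S8 + 4 * S3) * 2.
  by move=> T; ring.
by rewrite hx; ring.
Qed.

(** Since the entries of [r] sum to zero, [F n] may be replaced by [F n - F 1], and each divisor is
    then handled separately. *)
Lemma spanned_inS (N : nat) (r : nat -> int) : (0 < N)%N -> inS N r ->
  spanned 24 2 N (fun F => \sum_(n <- divisors N) F n * r n).
Proof.
move=> N0 rS.
have : forall n, n \in divisors N -> (n %| N)%N by move=> n; rewrite -dvdn_divisors.
suff h s : (forall n, n \in s -> (n %| N)%N) ->
    spanned 24 2 N (fun F => \sum_(n <- s) (F n - F 1%N) * r n).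
  move/h/spanned_congr; apply => q F _.
  rewrite -sumrB (eq_bigr (fun n => F 1%N * r n)); last by move=> n _; ring.
  by rewrite -mulr_sumr (rS : \sum_(n <- _) _ = 0) mulr0 dvdz0.
elim: s => [|n s IHs] hs.
  apply: spanned_congr (spanned0 _ _ _) _ => q F _.
  by rewrite big_nil subrr dvdz0.
have hn : (n %| N)%N by apply: hs; rewrite inE eqxx.
have {}IHs := IHs (fun m ms => hs m (mem_behead (s := n :: s) ms)).
apply: spanned_congr (spanned_lin _ _ _ (r n) 1 _ _ (spanned_mod24 _ _ N0 hn) IHs) _.
by move=> q F _; rewrite big_cons mul1r [r n * _]mulrC subrr dvdz0.
Qed.

(** * The lattice of relations and division with remainder *)

Lemma sum_repvec (N : nat) (b : seq nat) (d F : nat -> int) :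
  (0 < N)%N -> {subset b <= divisors N} ->
  \sum_(n <- divisors N) F n * repvec b d n =
  \sum_(j < size b) (F (nth 0%N b j) - F 1%N) * d j.
Proof.
move=> N0 bN.
have pick m x : m \in divisors N ->
    \sum_(n <- divisors N) F n * (if m == n then x else 0) = F m * x.
  move=> mN; rewrite (bigD1_seq m) ?divisors_uniq //= eqxx big1 ?addr0 // => n.
  by rewrite eq_sym => /negPf ->; rewrite mulr0.
under eq_bigr do rewrite mulrBr mulr_sumr [_ == 1%N]eq_sym.
rewrite sumrB exchange_big /= pick; last by rewrite -dvdn_divisors // dvd1n.
rewrite mulr_sumr -sumrB; apply: eq_bigr => j _.
by rewrite pick ?bN ?mem_nth // mulrBl.
Qed.

(** The lattice of relations modulo $Z(N)$ among the $e_{b_j} - e_1$, indexed by positions in [b] so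
    that its triangular shape is visible. *)
Definition in_kernel (N : nat) (b : seq nat) (d : nat -> int) : Prop :=
  forall q F, weight 24 2 N q F ->
    (q %| \sum_(j < size b) (F (nth 0%N b j) - F 1%N) * d j)%Z.

Section Kernel.

Variables (N : nat) (b : seq nat).
Hypotheses (N0 : (0 < N)%N) (bB : perm_eq b (BN N)).

Lemma in_kernel_lin x y d d' : in_kernel N b d -> in_kernel N b d' ->
  in_kernel N b (fun j => x * d j + y * d' j).
Proof.
move=> h h' q F w.
have := rpredD (dvdz_mull x (h q F w)) (dvdz_mull y (h' q F w)).
rewrite !mulr_sumr -big_split; congr (dvdz _ _); apply: eq_bigr => j _ /=; ring.
Qed.

Lemma in_kernel_ext d d' : (forall j, (j < size b)%N -> d j = d' j) ->
  in_kernel N b d -> in_kernel N b d'.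
Proof.
move=> dd' h q F w; have := h q F w; congr (dvdz _ _).
by apply: eq_bigr => j _; rewrite dd'.
Qed.

Lemma sum_BN_nth (c F : nat -> int) :
  \sum_(n <- BN N) (F n - F 1%N) * c n =
  \sum_(j < size b) (F (nth 0%N b j) - F 1%N) * c (nth 0%N b j).
Proof. by rewrite -(perm_big _ bB) /= (big_nth 0%N) big_mkord. Qed.

Lemma in_kernel_system c :
  systemS N c <-> in_kernel N b (fun j => c (nth 0%N b j)).
Proof.
rewrite systemSP //.
by split=> h q F w; have := h q F w; rewrite sum_BN_nth.
Qed.

Lemma uniq_b : uniq b.
Proof. by rewrite (perm_uniq bB) uniq_BN. Qed.

Lemma in_kernel_admissible d i m : (i < size b)%N -> in_kernel N b d ->
  (forall j, (j < i)%N -> d j = 0) -> d i = m%:Z -> admissible N b i m.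
Proof.
(* Since [b] has no repetitions, [index] carries coefficients from positions back to elements. *)
move=> ib kd d0 di; exists (fun n => d (index n b)); split.
- apply/in_kernel_system; apply: in_kernel_ext kd => j jb.
  by rewrite index_uniq // uniq_b.
- by move=> j ji; rewrite index_uniq ?uniq_b ?d0 // (ltn_trans ji).
by rewrite index_uniq ?uniq_b.
Qed.

Variable Delta : nat -> nat.
Hypothesis DeltaP : forall i, (i < size b)%N -> isDelta N b i (Delta i).

Notation reduced d := (forall j, (j < size b)%N -> 0 <= d j < (Delta j)%:Z).

(** Positions are reduced from left to right. The relation witnessing [Delta i] vanishes before
    position [i], so subtracting a multiple of it leaves the earlier entries intact. *)
Lemma reduced_exists d0 :
  exists2 d, reduced d & in_kernel N b (fun j => d0 j - d j).
Proof.
suff h i : (i <= size b)%N -> exists2 d : nat -> int,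
    (forall j, (j < i)%N -> 0 <= d j < (Delta j)%:Z) &
    in_kernel N b (fun j => d0 j - d j) by apply: h.
elim: i => [_|i IHi ib].
  exists d0 => // q F w; rewrite big1 ?dvdz0 // => j _.
  by rewrite subrr mulr0.
have [d dD dK] := IHi (ltnW ib).
have [/andP [D1 _] [c [cS c0 ci]] _] := DeltaP _ ib.
pose x := (d i %/ (Delta i)%:Z)%Z.
exists (fun j => d j - x * c (nth 0%N b j)).
  move=> j; rewrite ltnS leq_eqVlt => /orP [/eqP ->|ji]; last first.
    by rewrite c0 // mulr0 subr0 dD.
  have -> : d i - x * c (nth 0%N b i) = (d i %% (Delta i)%:Z)%Z.
    by rewrite ci [in LHS](divz_eq (d i) (Delta i)%:Z) -/x addrAC subrr add0r.
  have D0 : (Delta i)%:Z != 0 by move: D1; lia.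
  by rewrite modz_ge0 //= ltz_pmod //; move: D1; lia.
move/in_kernel_system: cS => cK.
apply: in_kernel_ext (in_kernel_lin 1 x _ _ dK cK) => j _; ring.
Qed.

(** At the first position where the two differ, the positive one of the two differences would be an
    admissible value below [Delta j], against minimality. *)
Lemma reduced_inj d d' : reduced d -> reduced d' ->
  in_kernel N b (fun j => d j - d' j) -> forall j, (j < size b)%N -> d j = d' j.
Proof.
move=> dD dD' K; elim/ltn_ind => j IHj jb.
have [_ _ Dmin] := DeltaP _ jb.
have lt0 e e' : reduced e -> reduced e' -> in_kernel N b (fun j => e j - e' j) ->
    (forall i, (i < j)%N -> e i = e' i) -> ~ (e' j < e j).
  move=> eD eD' eK eq lt.
  have [m mE] : exists m : nat, e j - e' j = m%:Z.
    by exists `|e j - e' j|%N; lia.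
  have := eD j jb; have := eD' j jb => h' h.
  apply: (Dmin m); [lia| lia |].
  apply: in_kernel_admissible eK _ mE => // i ij.
  by rewrite eq // subrr.
have eqd i : (i < j)%N -> d i = d' i by move=> ij; apply: IHj => //; apply: ltn_trans jb.
have K' : in_kernel N b (fun j => d' j - d j).
  by apply: in_kernel_ext (in_kernel_lin (-1) 0 _ _ K K) => i _; ring.
have := lt0 _ _ dD dD' K eqd.
have := lt0 _ _ dD' dD K' (fun i ij => esym (eqd i ij)).
lia.
Qed.

End Kernel.

(** * Existence and uniqueness of the representatives *)

Theorem theorem6p8 (N : nat) (b : seq nat) (Delta : nat -> nat) :
  (2 <= N)%N ->
  perm_eq b (BN N) ->
  (forall i, (i < size b)%N -> isDelta N b i (Delta i)) ->
  (forall d : nat -> int, inS N (repvec b d)) /\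
  (forall r : nat -> int, inS N r ->
     (exists d : nat -> int,
        (forall j, (j < size b)%N -> 0 <= d j < (Delta j)%:Z) /\
        inZ N (fun n => r n - repvec b d n)) /\
     (forall d d' : nat -> int,
        (forall j, (j < size b)%N -> 0 <= d j < (Delta j)%:Z) ->
        (forall j, (j < size b)%N -> 0 <= d' j < (Delta j)%:Z) ->
        inZ N (fun n => r n - repvec b d n) ->
        inZ N (fun n => r n - repvec b d' n) ->
        forall j, (j < size b)%N -> d j = d' j)).
Proof.
move=> N2 bB DeltaP; have N0 : (0 < N)%N by apply: ltn_trans N2.
have bN : {subset b <= divisors N}.
  by move=> n; rewrite (perm_mem bB) -dvdn_divisors //; apply: BN_dvd.
have repS d : inS N (repvec b d).
  (* The entries are summed by pairing with the constant function 1, whose differences [F n - F 1]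
     vanish. *)
  rewrite /inS; have := sum_repvec N b d (fun => 1) N0 bN.
  under eq_bigr do rewrite mul1r.
  by move=> ->; rewrite big1 // => j _; rewrite subrr mul0r.
split=> // r rS.
have sumZ d F : \sum_(n <- divisors N) F n * (r n - repvec b d n) =
    \sum_(n <- divisors N) F n * r n
    - \sum_(j < size b) (F (nth 0%N b j) - F 1%N) * d j.
  by rewrite -(sum_repvec N b d F) // -sumrB; apply: eq_bigr => n _; rewrite mulrBr.
split.
  have [c hc] := spanned_inS N r N0 rS.
  have [d dD dK] := reduced_exists N b N0 bB Delta DeltaP (fun j => c (nth 0%N b j)).
  exists d; split=> //; apply/inZP; split.
    by rewrite /inS sumrB (rS : \sum_(n <- _) _ = 0)
      (repS d : \sum_(n <- _) _ = 0) subrr.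
  move=> q F w; rewrite sumZ; have := rpredD (hc q F w) (dK q F w).
  rewrite (sum_BN_nth _ _ bB) -addrA; congr (dvdz _ (_ + _)).
  under [X in _ + X]eq_bigr do rewrite mulrBr.
  by rewrite sumrB addrA addNr add0r.
move=> d d' dD dD' /inZP [_ h] /inZP [_ h'].
apply: (reduced_inj N b N0 bB Delta DeltaP) => // q F w.
(* Subtracting the two congruences eliminates [r] and leaves a relation with coefficients
   [d j - d' j]. *)
have := rpredB (h' q F w) (h q F w); rewrite !sumZ.
have -> : forall t u v : int, t - u - (t - v) = v - u by move=> *; ring.
by rewrite -sumrB; congr (dvdz _ _); apply: eq_bigr => j _; rewrite mulrBr.
Qed.
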